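(* Consider a linear $L$-layer MPNN trained by gradient flow on a dataset $\{(G_i,\mathbf{X}_i,y_i)\}_{i=1}^k$ that is separable, i.e. there is $\bar{\mathbf{u}}\in\mathbb{R}^d$ with $y_i\,\bar{\mathbf{u}}^\top\mathbf{X}_i\mathbf{A}'(G_i)^L\mathbf{1}_{n_i}>0$ for all $i$. Suppose the loss $\ell:\mathbb{R}\to\mathbb{R}_{>0}$ has a continuous derivative with $\ell'(x)<0$ for all $x$, $\lim_{x\to-\infty}\ell(x)=\infty$ and $\lim_{x\to\infty}\ell(x)=0$, and that the initialisation satisfies $\mathcal{R}(\mathbf{W}(0))<\mathcal{R}(0)=\ell(0)$. For each $j$, let $\mathbf{u}_j(t)\in\mathbb{R}^{d_j}$ and $\mathbf{v}_j(t)\in\mathbb{R}^{d_{j-1}}$ be left and right singular vectors of $\mathbf{W}^{(j)}(t)$ for its largest singular value. Then: (i) for every $j=1,\dots,L$, $\lim_{t\to\infty}\big\|\mathbf{W}^{(j)}(t)/\|\mathbf{W}^{(j)}(t)\|_F-\mathbf{u}_j(t)\mathbf{v}_j(t)^\top\big\|_F=0$; (ii) $\lim_{t\to\infty}\Big|\Big\langle\dfrac{(\mathbf{W}^{(L)}(t)\cdots\mathbf{W}^{(1)}(t))^\top}{\prod_{j=1}^L\|\mathbf{W}^{(j)}(t)\|_F},\mathbf{v}_1(t)\Big\rangle\Big|=1$.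
   Context: For a graph $G$ on $n$ vertices, $\mathbf{A}(G)\in\{0,1\}^{n\times n}$ is its adjacency matrix, $\mathbf{A}'(G)=\mathbf{A}(G)+\mathbf{I}_n$, and $\mathbf{1}_n$ the all-ones vector. Training data: graphs $G_i$ on $n_i$ vertices, node feature matrices $\mathbf{X}_i\in\mathbb{R}^{d\times n_i}$ (columns = vertex features), labels $y_i\in\{-1,+1\}$; $\mathbf{Z}_i=y_i\mathbf{X}_i$. The linear MPNN has weights $\mathbf{W}=(\mathbf{W}^{(L)},\dots,\mathbf{W}^{(1)})$, $\mathbf{W}^{(j)}\in\mathbb{R}^{d_j\times d_{j-1}}$, $d_0=d$, $d_L=1$, and predicts $\hat y=\mathbf{W}^{(L)}\cdots\mathbf{W}^{(1)}\mathbf{X}\mathbf{A}'(G)^L\mathbf{1}_n$. The empirical risk is $\mathcal{R}(\mathbf{W})=\frac1k\sum_{i=1}^k\ell\big(\mathbf{W}^{(L)}\cdots\mathbf{W}^{(1)}\mathbf{Z}_i\mathbf{A}'(G_i)^L\mathbf{1}_{n_i}\big)$, and $\mathcal{R}(0)$ denotes its value at all-zero weights. Gradient flow: $\mathbf{W}(t)$, $t\ge0$, with $\frac{d\mathbf{W}(t)}{dt}=-\nabla\mathcal{R}(\mathbf{W}(t))$ from the initial state $\mathbf{W}(0)$. $\|\cdot\|_F$ is the Frobenius norm. *)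

(* Defs.v *)
From HB Require Import structures.
From mathcomp Require Import all_boot all_order all_algebra.
From mathcomp Require Import all_classical all_reals all_analysis.
Set Implicit Arguments. Unset Strict Implicit. Unset Printing Implicit Defensive.
Import Order.TTheory GRing.Theory Num.Theory.
Import numFieldNormedType.Exports.
Local Open Scope ring_scope.

Section Defs.
Context {R : realType}.

Definition frob (m n : nat) (M : 'M[R]_(m, n)) : R :=
  Num.sqrt (\sum_(i < m) \sum_(j < n) M i j ^+ 2).

Definition vnorm (m : nat) (x : 'cV[R]_m) : R := frob x.

Definition singular_triple (m n : nat) (W : 'M[R]_(m, n)) (s : R)
    (u : 'cV[R]_m) (v : 'cV[R]_n) : Prop :=
  [/\ 0 <= s, vnorm u = 1, vnorm v = 1, W *m v = s *: u & W^T *m u = s *: v].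

Definition top_singular_vectors (m n : nat) (W : 'M[R]_(m, n))
    (u : 'cV[R]_m) (v : 'cV[R]_n) : Prop :=
  exists s, singular_triple W s u v /\
    (forall s' u' v', singular_triple W s' u' v' -> s' <= s).

Definition adjmx (n : nat) (G : rel 'I_n) : 'M[R]_n :=
  \matrix_(p, q) (if G p q then 1 else 0).

Definition adjmx' (n : nat) (G : rel 'I_n) : 'M[R]_n := adjmx G + 1%:M.

Fixpoint mxpow (n : nat) (A : 'M[R]_n) (k : nat) : 'M[R]_n :=
  if k is k'.+1 then A *m mxpow A k' else 1%:M.

(* Weights: layer j+1 of the paper is  W j : 'M_(d (j+1), d j), j = 0..L-1 *)
Definition weights (d : nat -> nat) := forall j : nat, 'M[R]_(d j.+1, d j).

Fixpoint prodW (d : nat -> nat) (W : weights d) (m : nat) : 'M[R]_(d m, d 0%N) :=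
  if m is m'.+1 then W m' *m prodW W m' else 1%:M.

Definition scal (d : nat -> nat) (L : nat) (hL : d L = 1%N)
    (M : 'M[R]_(d L, 1)) : R :=
  (castmx (hL, erefl 1%N) M) ord0 ord0.

Definition aggfeat (d0 L n : nat) (G : rel 'I_n) (X : 'M[R]_(d0, n)) (y : R)
    : 'cV[R]_d0 :=
  (y *: X) *m mxpow (adjmx' G) L *m const_mx 1.

Definition risk (d : nat -> nat) (L : nat) (hL : d L = 1%N) (k : nat)
    (n : 'I_k -> nat) (G : forall i, rel 'I_(n i))
    (X : forall i, 'M[R]_(d 0%N, n i)) (y : 'I_k -> R) (ell : R -> R)
    (W : weights d) : R :=
  (k%:R)^-1 * \sum_(i < k) ell (scal hL (prodW W L *m aggfeat L (G i) (X i) (y i))).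

Definition zeroW (d : nat -> nat) : weights d := fun j => 0.

Definition pertW (d : nat -> nat) (W : weights d) (j a b : nat) (s : R) : weights d :=
  fun j' => W j' + \matrix_(p, q) (if [&& j' == j, (p : nat) == a & (q : nat) == b]
                                   then s else 0).

Definition partialW (d : nat -> nat) (F : weights d -> R) (W : weights d)
    (j a b : nat) : R :=
  derive1 (fun s => F (pertW W j a b s)) 0.

Definition endvec (d : nat -> nat) (L : nat) (hL : d L = 1%N) (W : weights d)
    : 'cV[R]_(d 0%N) :=
  castmx (erefl (d 0%N), hL) (prodW W L)^T.

End Defs.

(* Main.v *)
(* Gradient flow conserves [W_(j+1)^T W_(j+1) - W_j W_j^T].  Hence all squared
   Frobenius norms agree up to constants, and, since the last layer is a row, a
   downward induction bounds [|W_j|_F^2 - s_j^2], with [s_j] the largest singular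
   value.  If the norms tend to infinity, these bounded defects become negligible:
   each normalized layer tends to rank one, and balancedness also forces the
   cosine between [v_(j+1)] and [u_j] to [1] in absolute value, which gives the
   alignment of the product with [v_1].
   The norms do tend to infinity: in a bounded region where the risk is at most
   [R(W(0)) < l(0)], separability bounds the gradient away from 0, so that every
   return to such a region would cost a fixed amount of risk. *)

Require Import Defs.
From HB Require Import structures.
From mathcomp Require Import all_boot all_order all_algebra.
From mathcomp Require Import all_classical all_reals all_analysis.
From mathcomp Require Import ring lra.
Set Implicit Arguments. Unset Strict Implicit. Unset Printing Implicit Defensive.
Import Order.TTheory GRing.Theory Num.Theory.
Import numFieldNormedType.Exports.
Local Open Scope ring_scope.
Local Open Scope classical_set_scope.

(** * Limits of finite sums *)

Section Limits.
Context {R : realType} {T : Type} (F : set_system T) {FF : Filter F}.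

Lemma cvgr_sum (I : Type) (r : seq I) (P : pred I) (f : I -> T -> R) (l : I -> R) :
  (forall i, P i -> f i x @[x --> F] --> l i) ->
  \sum_(i <- r | P i) f i x @[x --> F] --> \sum_(i <- r | P i) l i.
Proof. by move=> fl; apply: cvg_big => //; exact: add_continuous. Qed.

End Limits.

(** * The Frobenius inner product and Cauchy-Schwarz *)

Section FrobeniusInnerProduct.
Context {R : realType}.

Definition dotm (m n : nat) (A B : 'M[R]_(m, n)) : R := \tr (A *m B^T).

Definition sqn (m n : nat) (A : 'M[R]_(m, n)) : R := dotm A A.

Lemma dotmE m n (A B : 'M[R]_(m, n)) :
  dotm A B = \sum_i \sum_j A i j * B i j.
Proof.
by apply: eq_bigr => i _; rewrite mxE; apply: eq_bigr => j _; rewrite mxE.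
Qed.

Lemma sqnE m n (A : 'M[R]_(m, n)) : sqn A = \sum_i \sum_j A i j ^+ 2.
Proof. by rewrite /sqn dotmE. Qed.

Lemma dotmC m n (A B : 'M[R]_(m, n)) : dotm A B = dotm B A.
Proof.
rewrite !dotmE; apply: eq_bigr => i _; apply: eq_bigr => j _.
by rewrite mulrC.
Qed.

Lemma dotmDl m n (A B C : 'M[R]_(m, n)) : dotm (A + B) C = dotm A C + dotm B C.
Proof. by rewrite /dotm mulmxDl mxtraceD. Qed.

Lemma dotmZl m n a (A B : 'M[R]_(m, n)) : dotm (a *: A) B = a * dotm A B.
Proof. by rewrite /dotm -scalemxAl mxtraceZ. Qed.

Lemma dotmNl m n (A B : 'M[R]_(m, n)) : dotm (- A) B = - dotm A B.
Proof. by rewrite -scaleN1r dotmZl mulN1r. Qed.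

Lemma dotmBl m n (A B C : 'M[R]_(m, n)) : dotm (A - B) C = dotm A C - dotm B C.
Proof. by rewrite dotmDl dotmNl. Qed.

Lemma dotmDr m n (A B C : 'M[R]_(m, n)) : dotm C (A + B) = dotm C A + dotm C B.
Proof. by rewrite !(dotmC C) dotmDl. Qed.

Lemma dotmZr m n a (A B : 'M[R]_(m, n)) : dotm B (a *: A) = a * dotm B A.
Proof. by rewrite !(dotmC B) dotmZl. Qed.

Lemma dotmBr m n (A B C : 'M[R]_(m, n)) : dotm C (A - B) = dotm C A - dotm C B.
Proof. by rewrite !(dotmC C) dotmBl. Qed.

Lemma dotm_mull m n p (A : 'M[R]_(m, n)) (B : 'M[R]_(n, p)) C :
  dotm (A *m B) C = dotm B (A^T *m C).
Proof. by rewrite /dotm trmx_mul trmxK -mulmxA mxtrace_mulC mulmxA. Qed.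

Lemma dotm_mulr m n p (A : 'M[R]_(m, n)) (B : 'M[R]_(n, p)) C :
  dotm (A *m B) C = dotm A (C *m B^T).
Proof. by rewrite /dotm trmx_mul trmxK mulmxA. Qed.

Lemma sqn_tr m n (A : 'M[R]_(m, n)) : sqn A^T = sqn A.
Proof. by rewrite /sqn /dotm trmxK mxtrace_mulC. Qed.

Lemma sqn_ge0 m n (A : 'M[R]_(m, n)) : 0 <= sqn A.
Proof. by rewrite sqnE; do 2!(apply: sumr_ge0 => ? _); exact: sqr_ge0. Qed.

Lemma sqnZ m n a (A : 'M[R]_(m, n)) : sqn (a *: A) = a ^+ 2 * sqn A.
Proof. by rewrite /sqn dotmZl dotmZr mulrA. Qed.

Lemma sqnD m n (A B : 'M[R]_(m, n)) :
  sqn (A + B) = sqn A + 2 * dotm A B + sqn B.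
Proof. by rewrite /sqn !(dotmDl, dotmDr) (dotmC B A); ring. Qed.

Lemma sqnB m n (A B : 'M[R]_(m, n)) :
  sqn (A - B) = sqn A - 2 * dotm A B + sqn B.
Proof. by rewrite /sqn !(dotmBl, dotmBr) (dotmC B A); ring. Qed.

Lemma sqn_eq0 m n (A : 'M[R]_(m, n)) : sqn A = 0 -> A = 0.
Proof.
rewrite sqnE => /eqP; rewrite psumr_eq0; last first.
  by move=> i _; apply: sumr_ge0 => j _; exact: sqr_ge0.
move=> /allP H; apply/matrixP => i j; rewrite mxE.
have := H i (mem_index_enum i); rewrite psumr_eq0; last by move=> *; exact: sqr_ge0.
by move=> /allP /(_ j (mem_index_enum j)); rewrite sqrf_eq0 => /eqP.
Qed.

Lemma sqr_frob m n (A : 'M[R]_(m, n)) : frob A ^+ 2 = sqn A.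
Proof. by rewrite /frob sqr_sqrtr -sqnE // sqn_ge0. Qed.

Lemma frob_ge0 m n (A : 'M[R]_(m, n)) : 0 <= frob A.
Proof. exact: sqrtr_ge0. Qed.

Lemma frobE m n (A : 'M[R]_(m, n)) : frob A = Num.sqrt (sqn A).
Proof. by rewrite sqnE. Qed.

Lemma dotm_Cauchy m n (A B : 'M[R]_(m, n)) : dotm A B ^+ 2 <= sqn A * sqn B.
Proof.
have := sqn_ge0 B; rewrite le_eqVlt => /predU1P[/esym B0|B0].
  by rewrite B0 mulr0 (sqn_eq0 B0) /dotm trmx0 mulmx0 mxtrace0 expr0n.
(* The residual of [A] along [B], scaled by [sqn B] to avoid a division. *)
have := sqn_ge0 (sqn B *: A - dotm A B *: B).
rewrite sqnB !sqnZ dotmZl dotmZr => H.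
have {}H : 0 <= sqn B * (sqn A * sqn B - dotm A B ^+ 2) by lra.
by move: H; rewrite pmulr_rge0 // subr_ge0.
Qed.

(** Cauchy-Schwarz entry by entry: each entry of the product pairs a row of [A] with a column of
    [B]. *)
Lemma sqn_mul m n p (A : 'M[R]_(m, n)) (B : 'M[R]_(n, p)) :
  sqn (A *m B) <= sqn A * sqn B.
Proof.
have -> : sqn A * sqn B = \sum_i \sum_j (sqn (row i A) * sqn (row j B^T)).
  rewrite -(sqn_tr B) !sqnE mulr_suml; apply: eq_bigr => i _.
  rewrite mulr_sumr; apply: eq_bigr => j _.
  by rewrite !sqnE !big_ord1; congr (_ * _); apply: eq_bigr => l _; rewrite !mxE.
rewrite [leLHS]sqnE; apply: ler_sum => i _; apply: ler_sum => j _.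
apply: le_trans (dotm_Cauchy _ _); rewrite dotmE big_ord1 mxE.
rewrite le_eqVlt; apply/orP; left; apply/eqP; congr (_ ^+ 2).
by apply: eq_bigr => l _; rewrite !mxE.
Qed.

(** The residual of [v] after projection on [u] has squared norm [1 - dotm v u ^+ 2]. When [v] is
    close to [u] or [- u], pairings with [u] thus pass over to [v] up to sign. *)
Lemma dotm_unit_Cauchy n (u v : 'cV[R]_n) (x : 'cV[R]_n) :
  sqn u = 1 -> sqn v = 1 -> sqn x <= 1 ->
  (dotm v x - dotm v u * dotm u x) ^+ 2 <= 1 - dotm v u ^+ 2.
Proof.
move=> u1 v1 x1.
have -> : dotm v x - dotm v u * dotm u x = dotm (v - dotm v u *: u) x.
  by rewrite dotmBl dotmZl.
apply: le_trans (dotm_Cauchy _ _) _.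
have -> : sqn (v - dotm v u *: u) = 1 - dotm v u ^+ 2.
  by rewrite sqnB sqnZ dotmZr u1 v1; ring.
rewrite -[leRHS]mulr1 ler_pM ?sqn_ge0 // subr_ge0.
by apply: le_trans (dotm_Cauchy _ _) _; rewrite u1 v1 mulr1.
Qed.

Lemma vnorm1_sqn n (x : 'cV[R]_n) : vnorm x = 1 -> sqn x = 1.
Proof. by rewrite /vnorm => x1; rewrite -sqr_frob x1 expr1n. Qed.

Lemma sqn_vnorm1 n (x : 'cV[R]_n) : sqn x = 1 -> vnorm x = 1.
Proof. by rewrite /vnorm frobE => ->; rewrite sqrtr1. Qed.

End FrobeniusInnerProduct.

(** * The largest singular value as an operator norm *)

Section TopSingularVectors.
Context {R : realType}.
Implicit Types (m n : nat).

Lemma continuous_sqn_mul m n (M : 'M[R]_(m, n)) :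
  continuous (fun x : 'rV[R]_m => sqn (x *m M)).
Proof.
move=> x; rewrite (_ : (fun _ => _) = fun x : 'rV[R]_m =>
    \sum_j (\sum_i x ord0 i * M i j) ^+ 2); last first.
  apply/funext => z; rewrite sqnE big_ord1; apply: eq_bigr => j _.
  by rewrite mxE.
apply: (@cvgr_sum R _ (nbhs x)) => j _; rewrite expr2.
have H : (\sum_i y ord0 i * M i j) @[y --> x] --> (\sum_i x ord0 i * M i j).
  apply: (@cvgr_sum R _ (nbhs x)) => i _; apply: cvgM; last exact: cvg_cst.
  exact: coord_continuous.
by apply: cvgM.
Qed.

Lemma compact_unit_sphere n : compact [set x : 'rV[R]_n | sqn x = 1].
Proof.
apply: bounded_closed_compact.
  exists 1; split => // M M1 x /= x1; apply: le_trans (ltW M1).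
  rewrite /Num.norm/= mx_normrE; apply: bigmax_le => //= -[i j] _ /=.
  rewrite -(ler_pXn2r (n:=2)) ?nnegrE // expr1n real_normK ?num_real // -x1.
  rewrite sqnE (bigD1 i)//= (bigD1 j)//= -addrA lerDl addr_ge0 //.
    by apply: sumr_ge0 => *; exact: sqr_ge0.
  by do 2![apply: sumr_ge0 => ? _]; exact: sqr_ge0.
rewrite (_ : [set _ | _] = (fun x => sqn (x *m 1%:M)) @^-1` [set 1]).
  move/continuous_closedP: (@continuous_sqn_mul n n 1%:M); apply.
  exact: closed_eq.
by apply/seteqP; split => x /=; rewrite mulmx1.
Qed.

(* The maximum of |W^T x| over the unit sphere is attained at a left singular
   vector, as first-order optimality makes it an eigenvector of W W^T. *)
Lemma top_singular_vectors_opnorm m n (W : 'M[R]_(m, n)) u v :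
  top_singular_vectors W u v ->
  exists2 s, singular_triple W s u v &
    forall x : 'cV[R]_m, sqn (W^T *m x) <= s ^+ 2 * sqn x.
Proof.
move=> [s [tri smax]]; exists s => //.
case: (tri) => s0 u1 v1 _ _.
have [x0 /= x01 x0max] : exists2 c : 'rV[R]_m, sqn c = 1 &
    forall t : 'rV[R]_m, sqn t = 1 -> sqn (t *m W) <= sqn (c *m W).
  have [|c] := @EVT_max_rV R m (fun x => sqn (x *m W)) [set x | sqn x = 1] _
    (@compact_unit_sphere m) (continuous_subspaceT (@continuous_sqn_mul m n W)).
    by exists u^T; rewrite /= sqn_tr vnorm1_sqn.
  rewrite inE /= => c1 cmax; exists c => // t t1; apply: cmax.
  by rewrite inE.
set l := sqn (x0 *m W) in x0max.
have psd (x : 'rV[R]_m) : sqn (x *m W) <= l * sqn x.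
  have := sqn_ge0 x; rewrite le_eqVlt => /predU1P[/esym x_eq0|x_gt0].
    by rewrite (sqn_eq0 x_eq0) mul0mx /sqn /dotm !mul0mx mxtrace0 mulr0.
  have : sqn (((frob x)^-1 *: x) *m W) <= l.
    by apply: x0max; rewrite sqnZ exprVn sqr_frob mulVf ?gt_eqF.
  by rewrite -scalemxAl sqnZ exprVn sqr_frob mulrC ler_pdivrMr.
have l0 : 0 <= l by exact: sqn_ge0.
suff ls : l <= s ^+ 2.
  move=> x; rewrite -(sqn_tr x) -sqn_tr trmx_mul trmxK.
  by apply: le_trans (psd _) _; rewrite ler_wpM2r ?sqn_ge0.
move: l0; rewrite le_eqVlt => /predU1P[<-|l_gt0]; first exact: sqr_ge0.
have eig : x0 *m W *m W^T = l *: x0.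
  apply/eqP; rewrite -subr_eq0; apply/eqP.
  set y := _ - _; apply: sqn_eq0.
  have dy : dotm (x0 *m W) (y *m W) - l * dotm x0 y = sqn y.
    by rewrite dotmC dotm_mulr dotmC /sqn {3}/y dotmBl dotmZl.
  (* Perturb the maximizer along the eigenvector residual [y]. The constant terms cancel and the
     linear coefficient is [- 2 * sqn y], which must vanish. *)
  have key (t : R) : 0 <= - 2 * t * sqn y + t ^+ 2 * (l * sqn y - sqn (y *m W)).
    have := psd (x0 + t *: y).
    rewrite mulmxDl -scalemxAl (sqnD x0) (sqnD (x0 *m W)) !sqnZ !dotmZr -/l x01.
    by rewrite -dy; lra.
  have y0 := sqn_ge0 y.
  set c := l * sqn y - sqn (y *m W) in key.
  have c0 : 0 <= c by rewrite subr_ge0 psd.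
  have c1 : 0 < c + 1 by lra.
  (* This [t] makes the quadratic negative unless [y = 0]. Dividing by [c + 1] rather than [c]
     covers [c = 0]. *)
  have := key ((c + 1)^-1 * sqn y).
  set i := (c + 1)^-1.
  have ic : i * (c + 1) = 1 by rewrite /i mulVf ?gt_eqF.
  have i0 : 0 < i by rewrite invr_gt0.
  have -> : - 2 * (i * sqn y) * sqn y + (i * sqn y) ^+ 2 * c =
    i * sqn y ^+ 2 * (i * (c + 1) - i - 2) by ring.
  rewrite ic => H.
  have : sqn y ^+ 2 <= 0.
    rewrite -(pmulr_rle0 _ i0); have := sqr_ge0 (sqn y); nra.
  by rewrite le_eqVlt ltNge sqr_ge0 orbF sqrf_eq0 => /eqP.
(* [smax] compares [s] only with singular values, so [mu] is exhibited as one, with left vector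
   [x0^T]; inverting it relies on [l > 0]. *)
set mu := Num.sqrt l.
have mu0 : 0 < mu by rewrite sqrtr_gt0.
have mu2 : mu ^+ 2 = l by rewrite sqr_sqrtr ?ltW.
rewrite -mu2 ler_pXn2r ?nnegrE ?(ltW mu0) //.
apply: (smax mu x0^T (mu^-1 *: (W^T *m x0^T))); split.
- exact: ltW.
- by apply: sqn_vnorm1; rewrite sqn_tr.
- apply: sqn_vnorm1; rewrite sqnZ -sqn_tr trmx_mul !trmxK -/l -mu2.
  by rewrite exprVn mulVf // sqrf_eq0 gt_eqF.
- have -> : W *m (mu^-1 *: (W^T *m x0^T)) = mu^-1 *: (x0 *m W *m W^T)^T.
    by rewrite -scalemxAr !trmx_mul trmxK.
  by rewrite eig linearZ scalerA -mu2 expr2 mulKf // gt_eqF.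
- by rewrite scalerA mulfV ?scale1r // gt_eqF.
Qed.

End TopSingularVectors.

(** * The gradient of the empirical risk by the product and chain rules *)

Section GradientOfRisk.
Context {R : realType}.

Lemma is_derive_sumE (n : nat) (h : 'I_n -> R -> R) (t : R) (dh : 'I_n -> R) :
  (forall i, is_derive t 1 (h i) (dh i)) ->
  is_derive t 1 (fun s => \sum_(i < n) h i s) (\sum_(i < n) dh i).
Proof.
move=> H; rewrite (_ : (fun s => _) = \sum_(i < n) h i); first exact: is_derive_sum.
by apply/funext => s; rewrite fct_sumE.
Qed.

Lemma is_derive_mulE (f g : R -> R) (t df dg : R) :
  is_derive t 1 f df -> is_derive t 1 g dg ->
  is_derive t 1 (fun s => f s * g s) (df * g t + f t * dg).
Proof.
move=> Hf Hg; rewrite (_ : (fun s => _) = f * g) //.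
by apply: is_derive_eq; rewrite /GRing.scale/= addrC mulrC.
Qed.

Lemma is_derive_mulmx (m n p : nat) (A : R -> 'M[R]_(m, n)) (B : R -> 'M[R]_(n, p))
    (t : R) (dA : 'M[R]_(m, n)) (dB : 'M[R]_(n, p)) :
  (forall a b, is_derive t 1 (fun s => A s a b) (dA a b)) ->
  (forall a b, is_derive t 1 (fun s => B s a b) (dB a b)) ->
  forall a b, is_derive t 1 (fun s => (A s *m B s) a b) ((dA *m B t + A t *m dB) a b).
Proof.
move=> HA HB a b; rewrite !mxE -big_split /=.
rewrite (_ : (fun s => _) = fun s => \sum_j A s a j * B s j b); last first.
  by apply/funext => s; rewrite mxE.
by apply: is_derive_sumE => j; exact: is_derive_mulE.
Qed.

Lemma is_derive_mx_cst (m n : nat) (A : 'M[R]_(m, n)) (t : R) :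
  forall a b, is_derive t 1 (fun=> A a b) ((0 : 'M[R]_(m, n)) a b).
Proof. by move=> a b; rewrite mxE; exact: is_derive_cst. Qed.

Context (d : nat -> nat).
Implicit Types (W V : weights (R := R) d).

(* The partial product [W (m-1) *m ... *m W j]; [pid_mx] stands for the identity
   when [j = m], which avoids casts between ['M_(d m, d j)] and ['M_(d m)]. *)
Fixpoint upW W (m j : nat) : 'M[R]_(d m, d j) :=
  if j == m then pid_mx (d m) else
  match m with
  | 0 => 0
  | m'.+1 => W m' *m upW W m' j
  end.

Lemma upWnn W m : upW W m m = 1%:M.
Proof. by case: m => [|m] /=; rewrite ?eqxx pid_mx_1. Qed.

Lemma upWS W m j : (j <= m)%N -> upW W m.+1 j = W m *m upW W m j.
Proof. by move=> jm /=; rewrite ltn_eqF. Qed.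

Lemma upW_mulr W m j : (j < m)%N -> upW W m j = upW W m j.+1 *m W j.
Proof.
elim: m j => // m IH j; rewrite ltnS leq_eqVlt => /predU1P[->|jm].
  by rewrite upWnn mul1mx upWS // upWnn mulmx1.
by rewrite upWS ?(ltnW jm) // IH // mulmxA -upWS.
Qed.

Lemma prodW_upW W m : prodW W m = upW W m 0.
Proof. by elim: m => [|m IH]; rewrite ?upWnn // upWS //= IH. Qed.

(** The Leibniz rule: the derivative of [prodW W m] in the direction [V]. *)
Definition dprodW W V (m : nat) : 'M[R]_(d m, d 0%N) :=
  \sum_(j < m) upW W m j.+1 *m V j *m prodW W j.

Lemma dprodWS W V m : dprodW W V m.+1 = V m *m prodW W m + W m *m dprodW W V m.
Proof.
rewrite /dprodW big_ord_recr /= eqxx pid_mx_1 mul1mx addrC mulmx_sumr.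
congr (_ + _); apply: eq_bigr => j _.
by rewrite eqSS ltn_eqF ?ltn_ord // -!mulmxA.
Qed.

Lemma is_derive_prodW (W : R -> weights d) V (t : R) m :
  (forall (j : nat) a b, (j < m)%N -> is_derive t 1 (fun s => W s j a b) (V j a b)) ->
  forall a b, is_derive t 1 (fun s => prodW (W s) m a b) (dprodW (W t) V m a b).
Proof.
elim: m => [_|m IH H] a b.
  by rewrite /dprodW big_ord0; exact: is_derive_mx_cst.
rewrite dprodWS; apply: is_derive_mulmx => [a' b'|].
  by apply: H.
by apply: IH => j *; apply: H; rewrite ltnS ltnW.
Qed.

Context (L : nat) (hL : d L = 1%N) (k : nat) (z : 'I_k -> 'cV[R]_(d 0%N)).
Context (ell : R -> R) (ell_der : forall x, derivable ell x 1).

(** The only index of ['I_(d L)]; selecting its row replaces casts along [hL]. *)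
Definition out : 'I_(d L) := cast_ord (esym hL) ord0.

Lemma scalE (M : 'M[R]_(d L, 1)) : scal hL M = M out ord0.
Proof. by rewrite /scal castmxE /=; congr (M _ _); apply: val_inj. Qed.

Lemma sqn_row_out n (M : 'M[R]_(d L, n)) : sqn (row out M) = sqn M.
Proof.
rewrite !sqnE big_ord1 [in RHS](bigD1 out) //= [X in _ + X]big1 ?addr0.
  by apply: eq_bigr => j _; rewrite mxE.
move=> i /negP[]; apply/eqP/val_inj => /=.
by have := ltn_ord i; rewrite [X in (_ < X)%N]hL; case: (nat_of_ord i).
Qed.

Lemma sqn_scal (M : 'M[R]_(d L, 1)) : sqn M = scal hL M ^+ 2.
Proof. by rewrite -sqn_row_out sqnE !big_ord1 mxE scalE. Qed.

Definition margin W (i : 'I_k) : R := scal hL (prodW W L *m z i).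

Definition emp_risk W : R := k%:R^-1 * \sum_(i < k) ell (margin W i).

(** The gradient of the risk as a function of the end-to-end vector alone. *)
Definition gradz W : 'cV[R]_(d 0%N) :=
  k%:R^-1 *: \sum_(i < k) derive1 ell (margin W i) *: z i.

(** The chain rule yields an outer product of two vectors, so its norm factors in the lower bound
    further down. *)
Definition gradW W (j : nat) : 'M[R]_(d j.+1, d j) :=
  (row out (upW W L j.+1))^T *m (prodW W j *m gradz W)^T.

(** The left side is the derivative of the risk in the direction [V]; expressing it by pairings with
    [V] identifies [gradW] as the gradient. *)
Lemma dot_gradW W V :
  k%:R^-1 * \sum_(i < k) derive1 ell (margin W i) * scal hL (dprodW W V L *m z i)
  = \sum_(j < L) dotm (V j) (gradW W j).
Proof.
have scal_lin (M : 'M[R]_(d L, d 0%N)) :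
    k%:R^-1 * \sum_(i < k) derive1 ell (margin W i) * scal hL (M *m z i) =
    (M *m gradz W) out ord0.
  rewrite /gradz -scalemxAr mxE; congr (_ * _).
  rewrite mulmx_sumr summxE; apply: eq_bigr => i _.
  by rewrite -scalemxAr scalE [in RHS]mxE.
rewrite scal_lin /dprodW mulmx_suml summxE; apply: eq_bigr => j _.
rewrite /dotm /gradW trmx_mul !trmxK mulmxA mxtrace_mulC mulmxA -!row_mul.
by rewrite trace_mx11 [RHS]mxE !mulmxA.
Qed.

Lemma is_derive_emp_risk (W : R -> weights d) V (t : R) :
  (forall (j : nat) a b, (j < L)%N -> is_derive t 1 (fun s => W s j a b) (V j a b)) ->
  is_derive t 1 (fun s => emp_risk (W s)) (\sum_(j < L) dotm (V j) (gradW (W t) j)).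
Proof.
move=> H; rewrite -dot_gradW /emp_risk.
apply: is_derive_eq.
  apply: (is_derive_mulE (f := fun=> k%:R^-1) (df := 0)).
  apply: (is_derive_sumE (dh := fun i => derive1 ell (margin (W t) i) *
    scal hL (dprodW (W t) V L *m z i))) => i.
  apply: (@is_derive1_comp _ ell (fun s => margin (W s) i)).
    by rewrite derive1E; exact: derivableP.
  rewrite /margin scalE; under eq_fun do rewrite scalE.
  have -> : (dprodW (W t) V L *m z i) =
    (dprodW (W t) V L *m z i + prodW (W t) L *m 0) by rewrite mulmx0 addr0.
  apply: (is_derive_mulmx (B := fun=> z i)); last exact: is_derive_mx_cst.
  exact: is_derive_prodW.
by rewrite mul0r add0r.
Qed.

(** The perturbation is affine in [s] along an elementary matrix [E], and pairing with [E] picks out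
    a single entry of the gradient. *)
Lemma partialW_emp_risk W (j : nat) (a : 'I_(d j.+1)) (b : 'I_(d j)) :
  (j < L)%N -> partialW emp_risk W j a b = gradW W j a b.
Proof.
move=> jL.
pose E : weights (R := R) d := fun j' =>
  \matrix_(p, q) (if [&& j' == j, (p : nat) == a & (q : nat) == b] then 1 else 0).
have pert0 : pertW W j a b 0 = W.
  apply: functional_extensionality_dep => i; apply/matrixP => p q.
  by rewrite !mxE if_same addr0.
have H : is_derive (0 : R) 1 (fun s => emp_risk (pertW W j a b s))
    (\sum_(i < L) dotm (E i) (gradW (pertW W j a b 0) i)).
  apply: is_derive_emp_risk => i p q _; rewrite !mxE.
  under eq_fun do rewrite !mxE.
  rewrite -[if _ then 1 else 0]add0r; apply: is_deriveD.
  by case: ifP => _; [exact: is_derive_id|exact: is_derive_cst].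
rewrite /partialW derive1E (derive_val (is_derive := H)) pert0.
rewrite (bigD1 (Ordinal jL)) //= [X in _ + X]big1 ?addr0; last first.
  move=> i; rewrite -val_eqE /= => ij; rewrite dotmE big1 // => p _.
  by rewrite big1 // => q _; rewrite mxE (negbTE ij) mul0r.
rewrite dotmE (bigD1 a) //= [X in _ + X]big1 ?addr0; last first.
  move=> p pa; rewrite big1 // => q _.
  by rewrite mxE val_eqE (negbTE pa) andbF mul0r.
rewrite (bigD1 b) //= [X in _ + X]big1 ?addr0; last first.
  by move=> q qb; rewrite mxE !eqxx val_eqE (negbTE qb) mul0r.
by rewrite mxE !eqxx mul1r.
Qed.

(** Moving one factor across the outer product turns both sides into the same matrix, with all
    layers above [j] on the left and all layers up to [j] on the right. This is the source of the
    conservation law. *)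
Lemma gradW_balance W j : (j.+1 < L)%N ->
  gradW W j *m (W j)^T = (W j.+1)^T *m gradW W j.+1.
Proof.
move=> jL; rewrite /gradW (upW_mulr W jL) row_mul [(_ *m W j.+1)^T]trmx_mul.
by rewrite -2!mulmxA -(trmx_mul (W j)) /= -(mulmxA (W j)).
Qed.

Lemma sqn_outer m n (x : 'cV[R]_m) (y : 'cV[R]_n) :
  sqn (x *m y^T) = sqn x * sqn y.
Proof.
rewrite !sqnE mulr_suml; apply: eq_bigr => i _; rewrite big_ord1 mulr_sumr.
by apply: eq_bigr => j _; rewrite big_ord1 !mxE big_ord1 mxE exprMn.
Qed.

End GradientOfRisk.

(** * A lower bound for the gradient in bounded regions of small risk *)

Section GradientLowerBound.
Context {R : realType} (d : nat -> nat) (L : nat) (hL : d L = 1%N).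
Context (k : nat) (z : 'I_k -> 'cV[R]_(d 0%N)) (ell : R -> R).
Implicit Types W : weights (R := R) d.

Lemma sqn_prodW_le W n (x : 'M[R]_(d 0%N, n)) m :
  sqn (prodW W m *m x) <= (\prod_(j < m) sqn (W j)) * sqn x.
Proof.
elim: m => [|m IH]; first by rewrite big_ord0 mul1r /= mul1mx.
rewrite big_ord_recr /= -mulmxA; apply: le_trans (sqn_mul _ _) _.
by rewrite [_ * sqn (W m)]mulrC -mulrA ler_wpM2l ?sqn_ge0.
Qed.

Definition sqnW W : R := \sum_(j < L) sqn (W j).

Lemma sqnW_ge0 W : 0 <= sqnW W.
Proof. by apply: sumr_ge0 => *; exact: sqn_ge0. Qed.

Lemma sqn_le_sqnW W j : (j < L)%N -> sqn (W j) <= sqnW W.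
Proof.
move=> jL; rewrite /sqnW (bigD1 (Ordinal jL)) //= lerDl.
by apply: sumr_ge0 => *; exact: sqn_ge0.
Qed.

Hypothesis ell_der : forall x, derivable ell x 1.
Hypothesis ell_der_cont : continuous (derive1 ell).
Hypothesis ell_der_neg : forall x, derive1 ell x < 0.

Lemma ell_continuous : continuous ell.
Proof. by move=> x; apply: differentiable_continuous; exact/derivable1_diffP. Qed.

Lemma ell_decr x y : x <= y -> ell y <= ell x.
Proof.
rewrite le_eqVlt => /predU1P[->//|xy].
have [|t _ H] := @MVT R ell (derive1 ell) x y xy _
    (continuous_subspaceT ell_continuous).
  by move=> t _; rewrite derive1E; exact: derivableP.
 rewrite -subr_le0 H nmulr_rle0 ?subr_ge0 ?(ltW xy) //.
Qed.

Lemma sqr_margin_le W i : margin hL z W i ^+ 2 <= (\prod_(j < L) sqn (W j)) * sqn (z i).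
Proof. by rewrite /margin -sqn_scal; exact: sqn_prodW_le. Qed.

Hypothesis L_gt0 : (0 < L)%N.
Hypothesis k_gt0 : (0 < k)%N.

(** The first layer is split off because [upW W L 1] is a factor of the first-layer gradient: a
    margin away from 0 keeps that factor away from 0. *)
Lemma sqr_margin_le_upW W i :
  margin hL z W i ^+ 2 <= sqn (upW W L 1) * sqnW W * sqn (z i).
Proof.
rewrite /margin -sqn_scal prodW_upW (upW_mulr W L_gt0).
apply: le_trans (sqn_mul _ _) _; rewrite ler_wpM2r ?sqn_ge0 //.
apply: le_trans (sqn_mul _ _) _; rewrite ler_wpM2l ?sqn_ge0 //.
exact: sqn_le_sqnW.
Qed.

(** By continuity at 0, [ell] still exceeds [r0] at some [x0 > 0]. If every margin were below [x0],
    monotonicity would make the average loss at least [ell x0]. *)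
Lemma emp_risk_lt_ell0_margin r0 : r0 < ell 0 ->
  exists2 x0, 0 < x0 & forall W, emp_risk hL z ell W <= r0 ->
    exists i, x0 <= margin hL z W i.
Proof.
move=> r0l.
have [x0 x0_gt0 ellx0] : exists2 x0, 0 < x0 & r0 < ell x0.
  have : \forall x \near (0 : R), r0 < ell x.
    by apply: (cvgr_gt _ (@ell_continuous 0)).
  move=> /nbhs_ballP[e /= e0 He]; exists (e / 2); first by rewrite divr_gt0.
  apply: He; rewrite /ball /= sub0r normrN gtr0_norm ?divr_gt0 //.
  by rewrite ltr_pdivrMr // ltr_pMr // ltr1n.
exists x0 => // W HW.
have [/existsP[i Hi]|/existsPn H] := boolP [exists i, x0 <= margin hL z W i].
  by exists i.
suff : r0 < emp_risk hL z ell W by rewrite ltNge HW.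
have k0 : (0 : R) < k%:R by rewrite ltr0n.
apply: lt_le_trans ellx0 _; rewrite /emp_risk mulrC ler_pdivlMr //.
have -> : ell x0 * k%:R = \sum_(i < k) ell x0.
  by rewrite sumr_const card_ord mulr_natr.
by apply: ler_sum => i _; apply: ell_decr; rewrite ltW // ltNge H.
Qed.

Lemma ell_der_bounded_away K : 0 <= K ->
  exists2 e, 0 < e & forall x, `|x| <= K -> derive1 ell x <= - e.
Proof.
move=> K0.
have [|c _ Hc] := @EVT_max R (derive1 ell) (- K) K _ (continuous_subspaceT ell_der_cont).
  by rewrite ge0_cp.
exists (- derive1 ell c); first by rewrite oppr_gt0.
by move=> x; rewrite ler_norml opprK => xK; apply: Hc; rewrite in_itv.
Qed.

Context (ub : 'cV[R]_(d 0%N)) (sep : forall i, 0 < dotm ub (z i)).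

(* Within a bounded region every margin stays bounded, so [ell'] is bounded away
   from 0 and separability bounds [gradz] from below along [ub]; the factor
   [W (L-1) ... W 1] of the first-layer gradient is bounded below because the
   risk assumption forces some margin, hence the end-to-end map, away from 0. *)
Lemma gradW0_lower_bound r0 B : r0 < ell 0 ->
  exists2 c, 0 < c & forall W, sqnW W <= B -> emp_risk hL z ell W <= r0 ->
    c <= sqn (gradW hL z ell W 0).
Proof.
move=> r0l; have [B0|B0] := ltP B 0.
  by exists 1 => // W WB; have := le_lt_trans WB B0; rewrite ltNge sqnW_ge0.
have [x0 x0_gt0 Hx0] := emp_risk_lt_ell0_margin r0l.
pose Z := \sum_i sqn (z i).
have Z0 : 0 <= Z by apply: sumr_ge0 => *; exact: sqn_ge0.
have zZ i : sqn (z i) <= Z.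
  by rewrite /Z (bigD1 i) //= lerDl sumr_ge0 // => *; exact: sqn_ge0.
(* The bound available concerns squared margins. The added 1 gives [K <= K ^+ 2], so [K] bounds the
   margins themselves. *)
pose K := B ^+ L * Z + 1.
have K1 : 1 <= K by rewrite lerDr mulr_ge0 ?exprn_ge0.
have [e e0 He] := ell_der_bounded_away (le_trans ler01 K1).
pose g := k%:R^-1 * \sum_i dotm ub (z i).
have k0 : (0 : R) < k%:R by rewrite ltr0n.
have g0 : 0 < g.
  rewrite mulr_gt0 ?invr_gt0 // (bigD1 (Ordinal k_gt0)) //= ltr_pwDl //.
  by apply: sumr_ge0 => i _; rewrite ltW.
(* [c1] and [c2] bound the two factors of the outer product; the added 1 keeps each denominator
   positive. *)
pose c1 := x0 ^+ 2 / (B * Z + 1).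
pose c2 := (e * g) ^+ 2 / (sqn ub + 1).
have BZ : 0 < B * Z + 1 by rewrite ltr_wpDl ?mulr_ge0.
have ub0 : 0 < sqn ub + 1 by rewrite ltr_wpDl ?sqn_ge0.
exists (c1 * c2).
  by apply: mulr_gt0; apply: divr_gt0 => //; apply: exprn_gt0 => //; exact: mulr_gt0.
move=> W WB Wr.
rewrite /gradW sqn_outer sqn_tr sqn_row_out /= mul1mx.
apply: ler_pM; rewrite ?divr_ge0 ?sqr_ge0 ?(ltW BZ) ?(ltW ub0) //.
  rewrite ler_pdivrMr //; have [i xi] := Hx0 _ Wr.
  have H : x0 ^+ 2 <= margin hL z W i ^+ 2.
    by rewrite ler_pXn2r ?nnegrE ?(ltW x0_gt0) // (le_trans (ltW x0_gt0)).
  apply: le_trans H _; apply: le_trans (sqr_margin_le_upW _ _) _.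
  rewrite -mulrA ler_wpM2l ?sqn_ge0 // ler_wpDr // ler_pM //.
    exact: sqnW_ge0.
  exact: sqn_ge0.
have Hm i : `|margin hL z W i| <= K.
  rewrite -(ler_pXn2r (n := 2)) ?nnegrE ?(le_trans ler01 K1) //.
  rewrite real_normK ?num_real //; apply: le_trans (sqr_margin_le _ _) _.
  apply: (@le_trans _ _ K); last by rewrite expr2 ler_peMr // (le_trans ler01 K1).
  rewrite ler_wpDr //; apply: ler_pM; rewrite ?sqn_ge0 //.
    by apply: prodr_ge0 => *; exact: sqn_ge0.
  rewrite -[X in _ ^+ X]card_ord -prodr_const; apply: ler_prod => j _.
  by rewrite sqn_ge0 (le_trans (sqn_le_sqnW W (ltn_ord j))).
rewrite ler_pdivrMr //.
apply: (@le_trans _ _ (dotm ub (gradz hL z ell W) ^+ 2)); last first.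
  apply: le_trans (dotm_Cauchy _ _) _; rewrite mulrC ler_wpM2l ?sqn_ge0 //.
  by rewrite lerDl.
have Hd : dotm ub (gradz hL z ell W) <= - (e * g).
  rewrite /gradz dotmZr /g mulrCA -mulrN ler_wpM2l ?invr_ge0 ?(ltW k0) //.
  rewrite (_ : dotm ub _ = \sum_i derive1 ell (margin hL z W i) * dotm ub (z i)).
    rewrite mulr_sumr -sumrN; apply: ler_sum => i _.
    by rewrite -mulNr ler_wpM2r ?(ltW (sep i)) // He.
  rewrite dotmC /dotm mulmx_suml [LHS]linear_sum /=; apply: eq_bigr => i _.
  by rewrite -/(dotm _ _) dotmZl dotmC.
have eg : 0 < e * g by exact: mulr_gt0.
by rewrite -[leRHS]sqrrN ler_pXn2r ?nnegrE //; lra.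
Qed.

End GradientLowerBound.

(** * Conservation, dissipation and growth along the gradient flow *)

Section GradientFlow.
Context {R : realType}.

(** The flow equation is given only at positive times, so the mean value theorem is stated on
    intervals that stay away from 0. *)
Lemma MVT_pos (f df : R -> R) (a b : R) :
  (forall t : R, 0 < t -> is_derive t 1 f (df t)) -> 0 < a -> a <= b ->
  exists2 c, a <= c <= b & f b - f a = df c * (b - a).
Proof.
move=> fdf a0 ab.
have [||c] := @MVT_segment R f df a b ab.
- by move=> x /itvP xab; apply: fdf; rewrite (lt_trans a0) // xab.
- apply: derivable_within_continuous => x xab.
  have x0 : 0 < x by rewrite (lt_le_trans a0) // (itvP xab).
  by have [] := fdf _ x0.
- by rewrite in_itv /= => cab E; exists c.
Qed.

Lemma le0_derive_pos_nincr (f df : R -> R) (a b : R) :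
  (forall t : R, 0 < t -> is_derive t 1 f (df t)) -> (forall t : R, 0 < t -> df t <= 0) ->
  0 < a -> a <= b -> f b <= f a.
Proof.
move=> fdf df0 a0 ab; have [c /andP[ac _] E] := MVT_pos fdf a0 ab.
by rewrite -subr_le0 E mulr_le0_ge0 ?subr_ge0 // df0 // (lt_le_trans a0).
Qed.

Lemma is_derive0_pos_cst (f : R -> R) (a b : R) :
  (forall t : R, 0 < t -> is_derive t 1 f 0) -> 0 < a -> 0 < b -> f a = f b.
Proof.
move=> fdf; wlog ab : a b / a <= b => [H a0 b0|a0 _].
  by have [/H->//|/ltW/H->//] := leP a b.
have [c _] := MVT_pos fdf a0 ab.
by rewrite mul0r => /eqP; rewrite subr_eq0 => /eqP.
Qed.

Lemma is_derive_tr (m n : nat) (A : R -> 'M[R]_(m, n)) (t : R) (dA : 'M[R]_(m, n)) :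
  (forall a b, is_derive t 1 (fun s => A s a b) (dA a b)) ->
  forall a b, is_derive t 1 (fun s => (A s)^T a b) (dA^T a b).
Proof. by move=> HA a b; rewrite mxE; under eq_fun do rewrite mxE. Qed.

Lemma is_derive_sqn (m n : nat) (A : R -> 'M[R]_(m, n)) (t : R) (dA : 'M[R]_(m, n)) :
  (forall a b, is_derive t 1 (fun s => A s a b) (dA a b)) ->
  is_derive t 1 (fun s => sqn (A s)) (2 * dotm (A t) dA).
Proof.
move=> HA; rewrite dotmE mulr_sumr.
rewrite (_ : (fun s => _) = fun s => \sum_i \sum_j A s i j * A s i j); last first.
  by apply/funext => s; rewrite /sqn dotmE.
apply: is_derive_sumE => i; rewrite mulr_sumr; apply: is_derive_sumE => j.
rewrite (_ : 2 * _ = dA i j * A t i j + A t i j * dA i j).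
  exact: is_derive_mulE.
by rewrite mulrDl mul1r [dA i j * _]mulrC.
Qed.

Context (d : nat -> nat) (L : nat) (hL : d L = 1%N).
Context (k : nat) (z : 'I_k -> 'cV[R]_(d 0%N)) (ell : R -> R).
Hypothesis ell_der : forall x, derivable ell x 1.
Context (W : R -> weights (R := R) d).
Local Notation grad t := (gradW hL z ell (W t)).
Local Notation risk t := (emp_risk hL z ell (W t)).
Hypothesis flow : forall t : R, 0 < t ->
  forall (j : nat) (a : 'I_(d j.+1)) (b : 'I_(d j)), (j < L)%N ->
  is_derive t 1 (fun s => W s j a b) (- grad t j a b).

Let flowN (t : R) : 0 < t -> forall (j : nat) (a : 'I_(d j.+1)) (b : 'I_(d j)),
  (j < L)%N -> is_derive t 1 (fun s => W s j a b) ((- grad t j) a b).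
Proof. by move=> *; rewrite mxE; exact: flow. Qed.

(** The derivative cancels by [gradW_balance] and its transpose. The reference time is 1 because the
    flow is differentiable only at positive times. *)
Lemma gradient_flow_balance j : (j.+1 < L)%N -> forall t : R, 0 < t ->
  (W t j.+1)^T *m W t j.+1 - W t j *m (W t j)^T =
  (W 1 j.+1)^T *m W 1 j.+1 - W 1 j *m (W 1 j)^T.
Proof.
move=> jL t t0; apply/matrixP => a b.
pose f (s : R) := ((W s j.+1)^T *m W s j.+1 - W s j *m (W s j)^T) a b.
apply: (@is_derive0_pos_cst f) => // s s0; rewrite /f.
have H1 := is_derive_tr (fun a b => flowN s0 a b jL).
have H2 := is_derive_tr (fun a b => flowN s0 a b (ltnW jL)).
have D1 := is_derive_mulmx H1 (fun a b => flowN s0 a b jL) a b.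
have D2 := is_derive_mulmx (fun a b => flowN s0 a b (ltnW jL)) H2 a b.
rewrite (_ : (fun s => _) = (fun s => ((W s j.+1)^T *m W s j.+1) a b) -
  (fun s => (W s j *m (W s j)^T) a b)); last first.
  by apply/funext => x; rewrite [LHS]mxE [X in _ + X]mxE.
apply: is_derive_eq.
have bal := gradW_balance hL z ell (W s) jL.
have balT : W s j *m (grad s j)^T = (grad s j.+1)^T *m W s j.+1.
  by rewrite -[W s j in LHS]trmxK -trmx_mul bal trmx_mul trmxK.
have trN m n (G : 'M[R]_(m, n)) : (- G)^T = - G^T by rewrite linearN.
by rewrite !trN !mulNmx !mulmxN -balT -bal (addrC (- (W s j *m (grad s j)^T))) subrr.
Qed.

Definition sqn_grad (t : R) : R := \sum_(j < L) sqn (grad t j).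

Lemma is_derive_risk_flow (t : R) : 0 < t ->
  is_derive t 1 (fun s => risk s) (- sqn_grad t).
Proof.
move=> t0; apply: is_derive_eq; first exact: (is_derive_emp_risk hL z ell_der (flowN t0)).
by rewrite -sumrN; apply: eq_bigr => j _; rewrite dotmNl.
Qed.

Lemma is_derive_sqnW_flow (t : R) : 0 < t ->
  is_derive t 1 (fun s => sqnW L (W s)) (- \sum_(j < L) 2 * dotm (W t j) (grad t j)).
Proof.
move=> t0; apply: is_derive_eq.
  apply: (is_derive_sumE (dh := fun j => 2 * dotm (W t j) (- grad t j))) => j.
  by apply: is_derive_sqn => a b; exact: flowN.
by rewrite -sumrN; apply: eq_bigr => j _; rewrite dotmC dotmNl mulrN dotmC.
Qed.

Lemma risk_flow_nincr (s t : R) : 0 < s -> s <= t -> risk t <= risk s.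
Proof.
move=> s0 st.
apply: (le0_derive_pos_nincr (f := fun x => risk x) is_derive_risk_flow _ s0 st).
by move=> x x0; rewrite oppr_le0; apply: sumr_ge0 => *; exact: sqn_ge0.
Qed.

Hypothesis ell_pos : forall x, 0 < ell x.

Lemma risk_ge0 (t : R) : 0 <= risk t.
Proof.
by rewrite mulr_ge0 ?invr_ge0 ?ler0n // sumr_ge0 // => i _; rewrite ltW.
Qed.

(* [|W|^2 + risk] grows at most exponentially: by AM-GM its derivative
   [-2 <W, grad> - |grad|^2] is at most [|W|^2]. *)
Lemma sqnW_flow_growth (s t : R) : 0 < s -> s <= t -> t <= s + 1 ->
  sqnW L (W t) <= (sqnW L (W s) + risk s) * expR 1.
Proof.
move=> s0 st ts1.
(* Gronwall's argument: the factor [expR (- x)] turns the growth bound into monotonicity. *)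
pose h (x : R) := (sqnW L (W x) + risk x) * expR (- x).
have hst : h t <= h s.
  pose D x := - (\sum_(j < L) 2 * dotm (W x j) (grad x j)) - sqn_grad x.
  pose S x := sqnW L (W x) + risk x.
  apply: (le0_derive_pos_nincr (f := h)
    (df := fun x => D x * expR (- x) + S x * (expR (- x) * -1)) _ _ s0 st) => x x0.
    apply: (is_derive_mulE (f := S) (g := fun y => expR (- y))).
      by apply: is_deriveD; [exact: is_derive_sqnW_flow|exact: is_derive_risk_flow].
  rewrite mulrN1 mulrN -mulrBl mulr_le0_ge0 ?expR_ge0 // subr_le0 /D /S.
  rewrite -opprD lerNl; apply: (@le_trans _ _ (- sqnW L (W x))).
    by rewrite lerN2 lerDl risk_ge0.
  rewrite /sqnW /sqn_grad -sumrN -big_split /=; apply: ler_sum => j _.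
  by have := sqn_ge0 (W x j + grad x j); rewrite sqnD; lra.
apply: (@le_trans _ _ (h t * expR t)).
  by rewrite /h -mulrA -expRD addNr expR0 mulr1 lerDl risk_ge0.
apply: (@le_trans _ _ (h s * expR t)); first by rewrite ler_wpM2r ?expR_ge0.
rewrite /h -mulrA -expRD ler_wpM2l ?addr_ge0 ?sqnW_ge0 ?risk_ge0 // ler_expR; lra.
Qed.

Hypothesis ell_der_cont : continuous (derive1 ell).
Hypothesis ell_der_neg : forall x, derive1 ell x < 0.
Hypothesis L_gt0 : (0 < L)%N.
Hypothesis k_gt0 : (0 < k)%N.
Context (ub : 'cV[R]_(d 0%N)) (sep : forall i, 0 < dotm ub (z i)).
Context (r0 : R) (r0_lt : r0 < ell 0) (risk_le : forall t : R, 0 < t -> risk t <= r0).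

(* Each visit of [sqnW] below [B] keeps it bounded for one unit of time and hence
   costs a fixed amount of risk; start where the risk is almost at its infimum. *)
Lemma sqnW_flow_unbounded B : exists2 s : R, 0 < s & forall t, s <= t -> B < sqnW L (W t).
Proof.
(* By [sqnW_flow_growth], [B'] bounds [sqnW] for one unit of time after any visit below [B]. *)
pose B' := (B + r0) * expR 1.
have [c c0 Hc] := gradW0_lower_bound hL ell_der ell_der_cont ell_der_neg L_gt0 k_gt0
  sep B' r0_lt.
pose E := [set risk t | t in [set t | 0 < t]].
have E_inf : has_inf E.
  split; first by exists (risk 1), 1 => //=.
  by exists 0 => _ [t _ <-]; exact: risk_ge0.
have [_ [s s0 <-] Hs] := inf_adherent c0 E_inf.
exists s => // t st; rewrite ltNge; apply/negP => tB.
have t0 : 0 < t by exact: lt_le_trans st.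
have [|x /andP[tx xt] Hx] := MVT_pos is_derive_risk_flow t0 (_ : t <= t + 1).
  by rewrite lerDl.
have x0 : 0 < x by exact: lt_le_trans tx.
have cx : c <= sqn_grad x.
  rewrite /sqn_grad (bigD1 (Ordinal L_gt0)) //= ler_wpDr //.
    by apply: sumr_ge0 => *; exact: sqn_ge0.
  apply: Hc; last exact: risk_le.
  apply: le_trans (sqnW_flow_growth t0 tx xt) _.
  by rewrite ler_wpM2r ?expR_ge0 // lerD // risk_le.
(* The risk at [t] is below [inf E + c] and drops by at least [c] on [[t, t + 1]], hence falls below
   its infimum. *)
have : inf E <= risk (t + 1).
  by apply: ge_inf; [case: E_inf|exists (t + 1) => //=; lra].
have := risk_flow_nincr s0 st; move: Hx Hs; rewrite [t + 1 - t]addrC addKr mulr1.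
by move=> *; lra.
Qed.

End GradientFlow.

(** * Right-continuity of the risk at the initial time *)

Section InitialRisk.
Context {R : realType} (d : nat -> nat) (L : nat) (hL : d L = 1%N).
Context (k : nat) (z : 'I_k -> 'cV[R]_(d 0%N)) (ell : R -> R).
Context (W : R -> weights (R := R) d).
Hypothesis W_cont0 : forall j a b, (fun t => W t j a b) x @[x --> 0^'+] --> W 0 j a b.

Lemma cvg_mulmx_entry (T : Type) (F : set_system T) {FF : Filter F} (m n p : nat)
    (A : T -> 'M[R]_(m, n)) (B : T -> 'M[R]_(n, p))
    (A0 : 'M[R]_(m, n)) (B0 : 'M[R]_(n, p)) :
  (forall a b, A x a b @[x --> F] --> A0 a b) ->
  (forall a b, B x a b @[x --> F] --> B0 a b) ->
  forall a b, (A x *m B x) a b @[x --> F] --> (A0 *m B0) a b.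
Proof.
move=> HA HB a b; rewrite mxE; under eq_cvg do rewrite mxE.
by apply: cvgr_sum => j _; exact: cvgM.
Qed.

(** This links the risk at time 0 to the positive times where the flow equation holds. *)
Lemma emp_risk_cvg_at0 : continuous ell ->
  emp_risk hL z ell (W t) @[t --> 0^'+] --> emp_risk hL z ell (W 0).
Proof.
move=> cell; apply: cvgM; first exact: cvg_cst.
apply: cvgr_sum => i _; apply: continuous_cvg; first exact: cell.
rewrite /margin scalE; under eq_cvg do rewrite /margin scalE.
apply: cvg_mulmx_entry; last by move=> *; exact: cvg_cst.
elim: L => [|m IH] a b /=; first exact: cvg_cst.
by apply: cvg_mulmx_entry.
Qed.

End InitialRisk.

(** * Rank-one approximation by a singular triple, and balanced pairs of layers *)

Section SingularTriple.
Context {R : realType}.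

Section OneMatrix.
Context (m n : nat) (W : 'M[R]_(m, n)) (s : R) (u : 'cV[R]_m) (v : 'cV[R]_n).
Hypothesis tri : singular_triple W s u v.

Lemma singular_sqn_u : sqn u = 1.
Proof. by case: tri => _ /vnorm1_sqn. Qed.

Lemma singular_sqn_v : sqn v = 1.
Proof. by case: tri => _ _ /vnorm1_sqn. Qed.

Lemma singular_value_ge0 : 0 <= s.
Proof. by case: tri. Qed.

Lemma singular_mulmx : W *m v = s *: u.
Proof. by case: tri. Qed.

Lemma singular_dotm_mulmx (x : 'cV[R]_n) : dotm u (W *m x) = s * dotm v x.
Proof. by case: tri => _ _ _ _ E; rewrite dotmC dotm_mull E dotmC dotmZl. Qed.

Lemma singular_value_sqr : sqn (W *m v) = s ^+ 2.
Proof. by rewrite singular_mulmx sqnZ singular_sqn_u mulr1. Qed.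

Lemma singular_value_sqr_le : s ^+ 2 <= sqn W.
Proof.
by rewrite -singular_value_sqr -[sqn W]mulr1 -singular_sqn_v; exact: sqn_mul.
Qed.

Lemma singular_value_le : s <= frob W.
Proof.
rewrite -(ler_pXn2r (n := 2)) ?nnegrE ?frob_ge0 ?singular_value_ge0 //.
by rewrite sqr_frob singular_value_sqr_le.
Qed.

Lemma dotm_singular : dotm W (u *m v^T) = s.
Proof.
rewrite dotmC dotm_mulr trmxK singular_mulmx dotmZr -[RHS]mulr1.
by rewrite -singular_sqn_u.
Qed.

Lemma sqn_singular_sub c : sqn (c *: W - u *m v^T) = c ^+ 2 * sqn W - 2 * c * s + 1.
Proof.
rewrite sqnB sqnZ dotmZl dotm_singular sqn_outer singular_sqn_u singular_sqn_v.
by ring.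
Qed.

(** Pythagoras: the remainder is orthogonal to [u *m v^T]. The defect [sqn W - s ^+ 2] thus measures
    the distance to rank one. *)
Lemma sqn_singular_remainder : sqn (W - s *: (u *m v^T)) = sqn W - s ^+ 2.
Proof.
rewrite sqnB sqnZ dotmZr dotm_singular sqn_outer singular_sqn_u singular_sqn_v.
by ring.
Qed.

(** Write [W] as [s *: (u *m v^T)] plus a remainder [E] with [E *m v = 0]. The two parts of
    [W^T *m x] are then orthogonal, and the norm of [E] is the defect. *)
Lemma sqn_trmul_le (x : 'cV[R]_m) :
  sqn (W^T *m x) <= s ^+ 2 * dotm u x ^+ 2 + (sqn W - s ^+ 2) * sqn x.
Proof.
pose E := W - s *: (u *m v^T).
have Ev : E *m v = 0.
  rewrite mulmxBl singular_mulmx -scalemxAl -mulmxA.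
  have -> : v^T *m v = 1%:M.
    rewrite [LHS]mx11_scalar; congr (_%:M).
    by rewrite -trace_mx11 -singular_sqn_v /sqn /dotm mxtrace_mulC.
  by rewrite mulmx1 subrr.
have -> : W^T *m x = E^T *m x + (s * dotm u x) *: v.
  have ux : u^T *m x = (dotm u x)%:M.
    rewrite [LHS]mx11_scalar; congr (_%:M).
    by rewrite -trace_mx11 dotmC /dotm mxtrace_mulC.
  rewrite /E linearB linearZ /= trmx_mul trmxK mulmxBl -scalemxAl -mulmxA ux.
  by rewrite mul_mx_scalar scalerA subrK.
rewrite sqnD sqnZ singular_sqn_v mulr1 exprMn.
rewrite dotmZr dotm_mull trmxK Ev {2}/dotm trmx0 mulmx0 mxtrace0 !mulr0 addr0 addrC.
rewrite lerD2l -sqn_singular_remainder -/E -(sqn_tr E); exact: sqn_mul.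
Qed.

Lemma opnorm_row : m = 1%N ->
  (forall x : 'cV[R]_m, sqn (W^T *m x) <= s ^+ 2 * sqn x) -> sqn W <= s ^+ 2.
Proof.
move=> m1; move: W; rewrite m1 => W1 /(_ 1%:M).
by rewrite mulmx1 sqn_tr [sqn 1%:M]sqnE !big_ord1 mxE expr1n mulr1.
Qed.

End OneMatrix.

Lemma dotm_dim1 m (x y : 'cV[R]_m) : m = 1%N -> dotm x y ^+ 2 = sqn x * sqn y.
Proof. by move=> m1; subst m; rewrite /sqn !dotmE !big_ord1; ring. Qed.

(** Only some constant is needed, so the crude [a <= 1 + a ^+ 2] replaces a square root. *)
Lemma dotm_mulmx_bound n (C : 'M[R]_n) (x : 'cV[R]_n) :
  sqn x = 1 -> dotm x (C *m x) <= 1 + sqn C.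
Proof.
move=> x1; have H : dotm x (C *m x) ^+ 2 <= sqn C.
  apply: le_trans (dotm_Cauchy _ _) _; rewrite x1 mul1r.
  by apply: le_trans (sqn_mul _ _) _; rewrite x1 mulr1.
have := sqr_ge0 (dotm x (C *m x) - 1); nra.
Qed.

Section ConsecutiveLayers.
Context (m n p : nat) (W : 'M[R]_(m, n)) (W' : 'M[R]_(p, m)) (C : 'M[R]_m).
Hypothesis balance : W'^T *m W' - W *m W^T = C.

Lemma balance_sqn : sqn W = sqn W' - \tr C.
Proof.
by rewrite -balance mxtraceD linearN /= mxtrace_mulC /sqn /dotm; ring.
Qed.

(** The balance identity is tested on [v]: [W'] contributes exactly [s ^+ 2], and the term in [C] is
    bounded by [1 + sqn C]. *)
Lemma balance_singular s (u : 'cV[R]_p) (v : 'cV[R]_m) :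
  singular_triple W' s u v -> s ^+ 2 - (1 + sqn C) <= sqn (W^T *m v).
Proof.
move=> tri; have v1 := singular_sqn_v tri.
rewrite -(singular_value_sqr tri) lerBlDr -lerBlDl.
apply: le_trans (dotm_mulmx_bound C v1).
rewrite -balance mulmxBl dotmBr -!mulmxA /sqn.
by rewrite [X in X - _ <= _]dotm_mull [X in _ - X <= _]dotm_mull trmxK.
Qed.

End ConsecutiveLayers.

End SingularTriple.

(** * Rank-one limits of the layers and alignment between them *)

Section Alignment.
Context {R : realType} (d : nat -> nat) (L : nat) (hL : d L = 1%N).
Context (W : R -> weights (R := R) d).
Context (u : forall j : nat, R -> 'cV[R]_(d j.+1)) (v : forall j : nat, R -> 'cV[R]_(d j)).
Hypothesis L_gt0 : (0 < L)%N.
Hypothesis uv_top : forall (j : nat) (t : R), (j < L)%N -> 0 <= t ->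
  top_singular_vectors (W t j) (u j t) (v j t).
Hypothesis balance : forall j, (j.+1 < L)%N -> forall t : R, 0 < t ->
  (W t j.+1)^T *m W t j.+1 - W t j *m (W t j)^T =
  (W 1 j.+1)^T *m W 1 j.+1 - W 1 j *m (W 1 j)^T.
Hypothesis unbounded : forall B, exists2 s : R, 0 < s & forall t, s <= t -> B < sqnW L (W t).

(** The singular value is recovered from its vectors, which gives a function of time in place of the
    existential in [top_singular_vectors]. *)
Definition topsv (j : nat) (t : R) : R := dotm (u j t) (W t j *m v j t).

Lemma topsvP (j : nat) (t : R) : (j < L)%N -> 0 <= t ->
  singular_triple (W t j) (topsv j t) (u j t) (v j t) /\
  forall x : 'cV[R]_(d j.+1), sqn ((W t j)^T *m x) <= topsv j t ^+ 2 * sqn x.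
Proof.
move=> jL t0; have [s tri op] := top_singular_vectors_opnorm (uv_top jL t0).
suff -> : topsv j t = s by [].
by rewrite /topsv (singular_mulmx tri) dotmZr -[dotm _ _]/(sqn _) (singular_sqn_u tri) mulr1.
Qed.

(** Traces of the balance identities show that squared layer norms differ by constants. Averaging
    expresses each through the total, so divergence of the total passes to every layer. *)
Lemma sqnW_layer (j : nat) (t : R) : (j < L)%N -> 0 < t ->
  sqn (W t j) = sqn (W 1 j) + (sqnW L (W t) - sqnW L (W 1)) / L%:R.
Proof.
have W0 i : (i < L)%N -> forall t : R, 0 < t ->
    sqn (W t i) = sqn (W 1 i) + (sqn (W t 0) - sqn (W 1 0)).
  elim: i => [_ x _|i IH iL x x0]; first by ring.
  have := balance_sqn (balance iL x0); have := balance_sqn (balance iL ltr01).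
  by rewrite (IH (ltnW iL) x x0); lra.
move=> jL t0; rewrite W0 //; congr (_ + _).
have -> : sqnW L (W t) = sqnW L (W 1) + (sqn (W t 0) - sqn (W 1 0)) * L%:R.
  rewrite -[X in _ * X%:R]card_ord mulr_natr -sumr_const -big_split /=.
  by apply: eq_bigr => i _; rewrite W0.
by rewrite [_ + _ - _]addrAC subrr add0r mulfK // gt_eqF // ltr0n.
Qed.

Lemma sqn_layer_cvgy j : (j < L)%N -> sqn (W t j) @[t --> +oo] --> +oo.
Proof.
move=> jL; apply/cvgryPgt => A.
have L0 : (0 : R) < L%:R by rewrite ltr0n.
have [s s0 Hs] := unbounded (sqnW L (W 1) + (A - sqn (W 1 j)) * L%:R).
near=> t.
have st : s <= t by near: t; apply: nbhs_pinfty_ge; exact: num_real.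
have t0 : 0 < t by exact: lt_le_trans st.
rewrite sqnW_layer // -ltrBlDl ltr_pdivlMr // ltrBrDl.
exact: Hs.
Unshelve. all: by end_near. Qed.

Lemma near_sqn_layer_gt0 j : (j < L)%N -> \forall t \near +oo, 0 < sqn (W t j).
Proof. by move=> /sqn_layer_cvgy/cvgryPgt/(_ 0). Qed.

Lemma cvg_div_sqn_layer j (K : R) : (j < L)%N -> K / sqn (W t j) @[t --> +oo] --> (0 : R).
Proof.
move=> jL; rewrite -[X in _ --> X](mulr0 K); apply: cvgM; first exact: cvg_cst.
by apply/gtr0_cvgV0; [exact: near_sqn_layer_gt0|exact: sqn_layer_cvgy].
Qed.

(* The last layer is a row, hence of rank one, so its defect
   [sqn W - topsv ^ 2] vanishes; balancedness propagates the bound downwards. *)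
Lemma singular_defect_bounded j : (j < L)%N ->
  exists K, forall t : R, 0 < t -> sqn (W t j) - topsv j t ^+ 2 <= K.
Proof.
(* [i] counts the layers above [j], so induction on it descends from the last layer. *)
move=> jL; have [i ji] : exists i, (j + i.+1)%N = L.
  by exists (L - j.+1)%N; rewrite addnS -addSn subnKC.
elim: i j jL ji => [|i IH] j jL ji.
  exists 0 => t t0; rewrite subr_le0.
  have [_ op] := topsvP jL (ltW t0); apply: opnorm_row op.
  by rewrite -[j.+1]addn1 ji.
have jL' : (j.+1 < L)%N by rewrite -ji addnS ltnS addnS ltnS leq_addr.
have [K HK] := IH j.+1 jL' (etrans (addSnnS j i.+1) ji).
set C := (W 1 j.+1)^T *m W 1 j.+1 - W 1 j *m (W 1 j)^T.
(* Passing to layer [j] costs [\tr C] in the squared norm and [1 + sqn C] in the squared singular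
   value. *)
exists (K - \tr C + (1 + sqn C)) => t t0.
have bal := balance jL' t0.
have [_ op] := topsvP jL (ltW t0); have [tri' _] := topsvP jL' (ltW t0).
have H1 := balance_singular bal tri'; have H2 := op (v j.+1 t).
rewrite (singular_sqn_v tri') mulr1 in H2.
have H3 := balance_sqn bal; have := HK t t0; rewrite -/C in H1 H3 *; lra.
Qed.

(** The ratio [r] lies in [[0, 1]], hence [r ^+ 2 <= r <= 1], and the bounded defect gives
    [1 - K / sqn (W t j) <= r ^+ 2]. *)
Lemma topsv_frob_cvg1 j : (j < L)%N -> topsv j t / frob (W t j) @[t --> +oo] --> (1 : R).
Proof.
move=> jL; have [K HK] := singular_defect_bounded jL.
apply: (@squeeze_cvgr _ _ _ _ (fun t => 1 - K / sqn (W t j)) (fun=> 1)).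
- near=> t.
  have N0 : 0 < sqn (W t j) by near: t; exact: near_sqn_layer_gt0.
  have t0 : 0 < t by near: t; apply: nbhs_pinfty_gt; exact: num_real.
  have [tri _] := topsvP jL (ltW t0).
  have f0 : 0 < frob (W t j) by rewrite frobE sqrtr_gt0.
  have r1 : topsv j t / frob (W t j) <= 1.
    by rewrite ler_pdivrMr // mul1r (singular_value_le tri).
  have r0 : 0 <= topsv j t / frob (W t j).
    by rewrite divr_ge0 ?(singular_value_ge0 tri) // ltW.
  rewrite r1 andbT; apply: (@le_trans _ _ ((topsv j t / frob (W t j)) ^+ 2)).
    rewrite expr_div_n sqr_frob lerBlDr -mulrDl ler_pdivlMr // mul1r.
    by have := HK t t0; lra.
  by rewrite expr2 ler_piMr.
- rewrite -[X in _ --> X]subr0; apply: cvgB; first exact: cvg_cst.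
  exact: cvg_div_sqn_layer.
- exact: cvg_cst.
Unshelve. all: by end_near. Qed.

(** Once the layer is nonzero, both matrices have norm 1 and their inner product is
    [topsv j t / frob (W t j)]. *)
Lemma rank_one_cvg j : (j < L)%N ->
  frob ((frob (W t j))^-1 *: W t j - u j t *m (v j t)^T) @[t --> +oo] --> (0 : R).
Proof.
move=> jL.
have H : Num.sqrt (2 - 2 * (topsv j t / frob (W t j))) @[t --> +oo] --> (0 : R).
  rewrite -[X in _ --> X]sqrtr0; apply: continuous_cvg; first exact: sqrt_continuous.
  rewrite -[X in _ --> X](subrr (2 * 1)) -{1}[2]mulr1; apply: cvgB; first exact: cvg_cst.
  by apply: cvgM; [exact: cvg_cst|exact: topsv_frob_cvg1].
apply: cvg_trans H; apply: near_eq_cvg; near=> t.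
have N0 : 0 < sqn (W t j) by near: t; exact: near_sqn_layer_gt0.
have t0 : 0 < t by near: t; apply: nbhs_pinfty_gt; exact: num_real.
have [tri _] := topsvP jL (ltW t0).
rewrite [frob (_ - _)]frobE (sqn_singular_sub tri) exprVn sqr_frob mulVf ?gt_eqF //.
by congr Num.sqrt; ring.
Unshelve. all: by end_near. Qed.

(** The quantity [sqn ((W t j)^T *m v j.+1 t)] is bounded below through balancedness and above by
    [sqn_trmul_le]. Up to constants this reads [sqn (W t j) <= sqn (W t j) * c], with [c] the
    squared cosine. *)
Lemma consecutive_alignment_cvg j : (j.+1 < L)%N ->
  dotm (v j.+1 t) (u j t) ^+ 2 @[t --> +oo] --> (1 : R).
Proof.
move=> jL'; have jL := ltnW jL'.
have [K HK] := singular_defect_bounded jL; have [K' HK'] := singular_defect_bounded jL'.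
set C := (W 1 j.+1)^T *m W 1 j.+1 - W 1 j *m (W 1 j)^T.
pose M := K + K' - \tr C + (1 + sqn C).
apply: (@squeeze_cvgr _ _ _ _ (fun t => 1 - M / sqn (W t j)) (fun=> 1)).
- near=> t.
  have N0 : 0 < sqn (W t j) by near: t; exact: near_sqn_layer_gt0.
  have t0 : 0 < t by near: t; apply: nbhs_pinfty_gt; exact: num_real.
  have bal := balance jL' t0.
  have [tri _] := topsvP jL (ltW t0); have [tri' _] := topsvP jL' (ltW t0).
  have v1 := singular_sqn_v tri'.
  apply/andP; split; last first.
    by apply: le_trans (dotm_Cauchy _ _) _; rewrite v1 (singular_sqn_u tri) mulr1.
  rewrite lerBlDr -lerBlDl ler_pdivlMr //.
  have H1 := balance_singular bal tri'; have H2 := sqn_trmul_le tri (v j.+1 t).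
  rewrite v1 mulr1 dotmC in H2; set c := dotm _ _ ^+ 2 in H2 *.
  have H3 : topsv j t ^+ 2 * c <= sqn (W t j) * c.
    by rewrite ler_wpM2r ?sqr_ge0 ?(singular_value_sqr_le tri).
  have H4 := balance_sqn bal; have := HK t t0; have := HK' t t0.
  by rewrite /M -/C in H1 H4 *; lra.
- rewrite -[X in _ --> X]subr0; apply: cvgB; first exact: cvg_cst.
  exact: cvg_div_sqn_layer.
- exact: cvg_cst.
Unshelve. all: by end_near. Qed.

Definition normalized_image (m : nat) (t : R) : 'cV[R]_(d m) :=
  (\prod_(j < m) frob (W t j))^-1 *: (prodW (W t) m *m v 0%N t).

Lemma sqn_normalized_image_le1 (m : nat) (t : R) : 0 <= t ->
  sqn (normalized_image m t) <= 1.
Proof.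
move=> t0; have [tri _] := topsvP L_gt0 t0.
have E : (\prod_(j < m) frob (W t j)) ^+ 2 = \prod_(j < m) sqn (W t j).
  by rewrite -prodrXl; apply: eq_bigr => j _; rewrite sqr_frob.
rewrite /normalized_image sqnZ exprVn E.
(* If some layer vanishes, the convention [0^-1 = 0] makes the normalized image zero. *)
have [->|P0] := eqVneq (\prod_(j < m) sqn (W t j)) 0.
  by rewrite invr0 mul0r ler01.
have {}P0 : 0 < \prod_(j < m) sqn (W t j).
  by rewrite lt_neqAle eq_sym P0 prodr_ge0 // => *; exact: sqn_ge0.
rewrite mulrC ler_pdivrMr // mul1r; apply: le_trans (sqn_prodW_le _ _ _) _.
by rewrite (singular_sqn_v tri) mulr1.
Qed.

(** Moving [W t m] to the other side of the pairing sends [u m t] to a multiple of [v m t]: a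
    recursion across one layer. *)
Lemma dotm_normalized_imageS (m : nat) (t : R) : (m < L)%N -> 0 <= t ->
  dotm (u m t) (normalized_image m.+1 t) =
  topsv m t / frob (W t m) * dotm (v m t) (normalized_image m t).
Proof.
move=> mL t0; have [tri _] := topsvP mL t0.
rewrite /normalized_image big_ord_recr /= !dotmZr -mulmxA (singular_dotm_mulmx tri).
by rewrite invfM; ring.
Qed.

(** Two moves alternate: [step] crosses a layer at the cost of a ratio tending to 1, and the
    near-collinearity of [u m t] and [v m.+1 t] crosses the interface to the next layer. *)
Lemma normalized_image_alignment_cvg m : (m < L)%N ->
  `|dotm (u m t) (normalized_image m.+1 t)| @[t --> +oo] --> (1 : R).
Proof.
have step i : (i < L)%N ->
    `|dotm (v i t) (normalized_image i t)| @[t --> +oo] --> (1 : R) ->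
    `|dotm (u i t) (normalized_image i.+1 t)| @[t --> +oo] --> (1 : R).
  move=> iL Hi.
  have H : `|topsv i t / frob (W t i)| * `|dotm (v i t) (normalized_image i t)|
      @[t --> +oo] --> (1 : R).
    rewrite -[X in _ --> X](mulr1 1); apply: cvgM => //.
    by rewrite -[X in _ --> X]normr1; apply: cvg_norm; exact: topsv_frob_cvg1.
  apply: cvg_trans H; apply: near_eq_cvg; near=> t.
  by rewrite dotm_normalized_imageS ?normrM.
elim: m => [|m IH] mL.
  apply: step => //; apply: (@cvg_trans _ ((fun=> 1 : R) @ +oo)); last exact: cvg_cst.
  apply: near_eq_cvg; near=> t.
  have t0 : 0 <= t by near: t; apply: nbhs_pinfty_ge; exact: num_real.
  have [tri _] := topsvP L_gt0 t0.
  rewrite /normalized_image big_ord0 invr1 scale1r /= mul1mx.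
  by rewrite -/(sqn _) (singular_sqn_v tri) normr1.
apply: step => //; have mL' := ltnW mL.
have cos1 := consecutive_alignment_cvg mL.
have cosn1 : `|dotm (v m.+1 t) (u m t)| @[t --> +oo] --> (1 : R).
  have H : Num.sqrt (dotm (v m.+1 t) (u m t) ^+ 2) @[t --> +oo] --> (1 : R).
    by rewrite -[X in _ --> X]sqrtr1; apply: continuous_cvg => //; exact: sqrt_continuous.
  by apply: cvg_trans H; apply: near_eq_cvg; near=> t; rewrite sqrtr_sqr.
(* The error from [dotm_unit_Cauchy] when [v m.+1 t] is replaced by its projection on [u m t]. *)
pose err t := Num.sqrt (1 - dotm (v m.+1 t) (u m t) ^+ 2).
have err0 : err t @[t --> +oo] --> (0 : R).
  rewrite -[X in _ --> X]sqrtr0; apply: continuous_cvg; first exact: sqrt_continuous.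
  by rewrite -[X in _ --> X](subrr 1); apply: cvgB => //; exact: cvg_cst.
apply: (@squeeze_cvgr _ _ _ _ (fun t => `|dotm (v m.+1 t) (u m t)| *
  `|dotm (u m t) (normalized_image m.+1 t)| - err t) (fun=> 1)).
- near=> t.
  have t0 : 0 <= t by near: t; apply: nbhs_pinfty_ge; exact: num_real.
  have [tri _] := topsvP mL' t0; have [tri' _] := topsvP mL t0.
  have u1 := singular_sqn_u tri; have v1 := singular_sqn_v tri'.
  have x1 := sqn_normalized_image_le1 m.+1 t0.
  apply/andP; split; last first.
    rewrite -(ler_pXn2r (n := 2)) ?nnegrE // expr1n real_normK ?num_real //.
    by apply: le_trans (dotm_Cauchy _ _) _; rewrite v1 mul1r.
  rewrite lerBlDr -lerBlDl -normrM; apply: le_trans (lerB_dist _ _) _.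
  rewrite distrC -sqrtr_sqr ler_sqrt ?dotm_unit_Cauchy //.
  by rewrite subr_ge0; apply: le_trans (dotm_Cauchy _ _) _; rewrite v1 u1 mulr1.
- rewrite -[X in _ --> X]subr0 -[X in _ --> X - _](mulr1 1); apply: cvgB => //.
  by apply: cvgM => //; exact: IH.
- exact: cvg_cst.
Unshelve. all: by end_near. Qed.

End Alignment.

(** * From the layers to the end-to-end vector and the two limits *)

Lemma endvecE (R : realType) (d : nat -> nat) (L : nat) (hL : d L = 1%N)
    (W : weights (R := R) d) (x : 'cV[R]_(d 0%N)) :
  ((endvec hL W)^T *m x) ord0 ord0 = scal hL (prodW W L *m x).
Proof.
rewrite scalE !mxE; apply: eq_bigr => i _; congr (_ * _).
rewrite mxE /endvec castmxE /= mxE; congr (prodW W L _ _); exact: val_inj.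
Qed.

(** With at least one layer the product of zero weights is 0 rather than the identity; [k > 0] makes
    the average of a constant equal to it. *)
Lemma emp_risk_zeroW (R : realType) (d : nat -> nat) (L : nat) (hL : d L = 1%N)
    (k : nat) (z : 'I_k -> 'cV[R]_(d 0%N)) (ell : R -> R) :
  (0 < L)%N -> (0 < k)%N -> emp_risk hL z ell (@zeroW R d) = ell 0.
Proof.
case: L hL => // l hl _ k0; rewrite /emp_risk.
rewrite (eq_bigr (fun=> ell 0)) => [|i _]; last first.
  by rewrite /margin scalE /= /zeroW !mul0mx mxE.
by rewrite sumr_const card_ord -[ell 0 *+ k]mulr_natl mulKf // pnatr_eq0 -lt0n.
Qed.

Theorem theorem20 (R : realType)
  (L : nat) (d : nat -> nat) (hL : d L = 1%N) (L_gt0 : (0 < L)%N)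
  (k : nat) (k_gt0 : (0 < k)%N) (n : 'I_k -> nat)
  (G : forall i : 'I_k, rel 'I_(n i))
  (G_sym : forall i, symmetric (G i)) (G_irr : forall i, irreflexive (G i))
  (X : forall i : 'I_k, 'M[R]_(d 0%N, n i)) (y : 'I_k -> R)
  (y_pm : forall i, y i = 1 \/ y i = -1)
  (separable : exists ub : 'cV[R]_(d 0%N), forall i : 'I_k,
      0 < y i * (ub^T *m (X i *m mxpow (adjmx' (G i)) L *m (const_mx 1 : 'cV[R]_(n i)))) ord0 ord0)
  (ell : R -> R)
  (ell_pos : forall x, 0 < ell x)
  (ell_der : forall x, derivable ell x 1)
  (ell_der_cont : continuous (derive1 ell))
  (ell_der_neg : forall x, derive1 ell x < 0)
  (ell_lim_m : ell x @[x --> -oo] --> +oo)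
  (ell_lim_p : ell x @[x --> +oo] --> 0)
  (W : R -> weights d)
  (W_cont0 : forall j a b, (fun t => W t j a b) x @[x --> 0^'+] --> W 0 j a b)
  (W_flow : forall t : R, 0 < t -> forall (j : nat) (a : 'I_(d j.+1)) (b : 'I_(d j)),
      (j < L)%N ->
      is_derive t 1 (fun s => W s j a b)
        (- partialW (risk hL G X y ell) (W t) j a b))
  (W_init : risk hL G X y ell (W 0) < risk hL G X y ell (zeroW d))
  (u : forall j : nat, R -> 'cV[R]_(d j.+1))
  (v : forall j : nat, R -> 'cV[R]_(d j))
  (uv_top : forall (j : nat) (t : R), (j < L)%N -> 0 <= t ->
      top_singular_vectors (W t j) (u j t) (v j t)) :
  (forall j, (j < L)%N ->
     frob ((frob (W t j))^-1 *: W t j - u j t *m (v j t)^T) @[t --> +oo] --> (0 : R))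
  /\
  `| ((endvec hL (W t))^T *m v 0%N t) ord0 ord0
       / \prod_(j < L) frob (W t j) | @[t --> +oo] --> (1 : R).
Proof.
pose z i := aggfeat L (G i) (X i) (y i).
have [ub Hub] := separable.
have sep i : 0 < dotm ub (z i).
  rewrite /z /aggfeat -!scalemxAl dotmZr; move: (Hub i); set w := X i *m _ *m _.
  by rewrite -trace_mx11 dotmC /dotm mxtrace_mulC.
have flow (t : R) : 0 < t -> forall (j : nat) (a : 'I_(d j.+1)) (b : 'I_(d j)),
    (j < L)%N ->
    is_derive t 1 (fun s => W s j a b) (- gradW hL z ell (W t) j a b).
  move=> t0 j a b jL; rewrite -(partialW_emp_risk hL z ell_der) //.
  exact: W_flow.
have risk_lt : emp_risk hL z ell (W 0) < ell 0.
  by rewrite -(emp_risk_zeroW hL z ell L_gt0 k_gt0); exact: W_init.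
have risk_le (t : R) : 0 < t -> emp_risk hL z ell (W t) <= emp_risk hL z ell (W 0).
  (* The earlier time in [risk_flow_nincr] tends to 0 from the right. *)
  move=> t0; apply: (cvgr_to_ge (emp_risk_cvg_at0 W_cont0 (ell_continuous ell_der))).
  near=> s.
  have s0 : 0 < s by near: s; exact: nbhs_right_gt.
  apply: (risk_flow_nincr ell_der flow s0).
  by near: s; exact: nbhs_right_le.
have balance := gradient_flow_balance flow.
have unbounded := sqnW_flow_unbounded ell_der flow ell_pos ell_der_cont ell_der_neg
  L_gt0 k_gt0 sep risk_lt risk_le.
split; first by move=> j jL; exact: (rank_one_cvg hL L_gt0 uv_top balance unbounded).
have lL : (L.-1 < L)%N by rewrite prednK.
have := normalized_image_alignment_cvg hL L_gt0 uv_top balance unbounded lL.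
apply: cvg_trans; apply: near_eq_cvg; near=> t.
have t0 : 0 <= t by near: t; apply: nbhs_pinfty_ge; exact: num_real.
have [tri _] := topsvP uv_top lL t0.
rewrite endvecE -[LHS]sqrtr_sqr -[RHS]sqrtr_sqr; congr Num.sqrt.
(* The last left singular vector is a unit vector in dimension [d L = 1], so pairing with it gives
   the absolute value of the output. *)
rewrite dotm_dim1 ?prednK // (singular_sqn_u tri) mul1r prednK //.
by rewrite /normalized_image sqnZ (sqn_scal hL) exprMn mulrC.
Unshelve. all: by end_near. Qed.
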